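(* Let $k\ge1$ and $0\le H\le k/2$ be integers, and let $U=2^H\sum_{i=0}^{H}\binom{k-H}{i}$. In the noisy advice model with $k$ queries of which at most $H$ may be answered erroneously, there is a contract scheduling scheme whose acceleration ratio is at most \[ \frac{1+U}{2^k}\Big(1+\frac{2^k}{1+U}\Big)^{1+\frac{1+U}{2^k}}. \]
   Context: A single-processor contract schedule is a strictly increasing sequence $X=(x_i)_{i\ge0}$ of positive reals, contracts run back to back from time $0$; for an interruption time $T$, $\ell(X,T)$ is the largest length of a contract completed by time $T$ (with $T/\ell=\infty$ if none). Noisy advice model: an adversary fixes an unknown interruption time $T>0$. Before execution, the scheduler adaptively asks $k$ yes/no queries about $T$, each of the form ''is $T\in S$?'' for a set $S\subseteq(0,\infty)$ of its choice; an adversary who knows $T$ answers them, and may answer at most $H$ of them incorrectly, where $H$ is known to the scheduler. Based on the $k$ answers the scheduler selects a single-processor schedule, which is then executed. Let $\mathcal X$ be the (finite) set of schedules the scheme can select and $T_0$ the maximum first contract length over $\mathcal X$. The acceleration ratio of the scheme is the supremum, over all $T\ge T_0$ and all answer sequences for $T$ with at most $H$ wrong answers, of $T/\ell(X,T)$ where $X$ is the schedule selected. *)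

(* Defs.v *)
From HB Require Import structures.
From mathcomp Require Import all_boot all_order all_algebra.
From mathcomp Require Import all_classical all_reals all_analysis.

Set Implicit Arguments.
Unset Strict Implicit.
Unset Printing Implicit Defensive.

Import Order.TTheory GRing.Theory Num.Theory.

Local Open Scope classical_set_scope.
Local Open Scope ring_scope.

Record schedule (R : realType) := Schedule {
  contract_length :> nat -> R;
  contract_length_gt0 : forall i, 0 < contract_length i;
  contract_length_incr :
    {homo contract_length : i j / (i < j)%N >-> i < j} }.

(* Contracts run back to back from time 0. *)
Definition finish_time (R : realType) (X : schedule R) (i : nat) : R :=
  \sum_(j < i.+1) X j.

Definition completed (R : realType) (X : schedule R) (T : R) : set nat :=
  [set i | finish_time X i <= T].

(* The supremum is attained when some contract is completed by time T
   (lemma longest_completed_max below); otherwise it has the junk value 0. *)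
Definition longest_completed (R : realType) (X : schedule R) (T : R) : R :=
  sup [set X i | i in completed X T].

Definition performance_ratio (R : realType) (X : schedule R) (T : R) : \bar R :=
  if `[< completed X T !=set0 >] then (T / longest_completed X T)%:E
  else +oo%E.

Lemma longest_completed_max (R : realType) (X : schedule R) (T : R) :
  completed X T !=set0 ->
  exists2 i, completed X T i &
    longest_completed X T = X i /\ forall j, completed X T j -> X j <= X i.
Proof.
move=> [i0 Ti0].
have X0 := contract_length_gt0 X 0.
have X0le i : X 0%N <= X i.
  by case: i => // i; apply/ltW/contract_length_incr.
have finish_ge i : X 0%N *+ i.+1 <= finish_time X i.
  rewrite -[in X in X <= _](card_ord i.+1) -sumr_const.
  exact: ler_sum.
have bnd i : completed X T i -> (i <= Num.truncn (T / X 0%N))%N.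
  move=> Ti; have T0 : 0 <= T.
    apply: le_trans Ti; apply: sumr_ge0 => j _.
    exact/ltW/contract_length_gt0.
  have le_iT : i%:R <= T / X 0%N.
    rewrite ler_pdivlMr // mulr_natl; apply: le_trans Ti.
    by apply: le_trans (finish_ge i); rewrite ler_wpMn2l // ltW.
  rewrite -ltnS -(ltr_nat R); apply: le_lt_trans le_iT _.
  exact: truncnS_gt.
have exP : exists i, `[< completed X T i >] by exists i0; apply/asboolP.
have bndb i : `[< completed X T i >] -> (i <= Num.truncn (T / X 0%N))%N.
  by move=> /asboolP /bnd.
case: (ex_maxnP exP bndb) => m /asboolP Tm mmax.
have Xmax j : completed X T j -> X j <= X m.
  move=> /asboolP /mmax; rewrite leq_eqVlt => /orP[/eqP -> //|lt_jm].
  exact/ltW/contract_length_incr.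
exists m => //; split=> //; apply/eqP; rewrite eq_le; apply/andP; split.
  by apply: ge_sup => [|_ [j Tj <-]]; [exists (X m), m | exact: Xmax].
apply: ub_le_sup; last by exists m.
by exists (X m) => _ [j Tj <-]; exact: Xmax.
Qed.

(* An adaptive k-query scheme: [query s h] is the set S of the next question
   "is T in S?" once the answers h (in chronological order) were received. *)
Record scheme (R : realType) (k : nat) := Scheme {
  query : seq bool -> set R;
  query_gt0 : forall h t, query h t -> 0 < t;
  select : k.-tuple bool -> schedule R }.

Definition wrong_answers (R : realType) (k : nat) (s : scheme R k) (T : R)
    (a : k.-tuple bool) : {set 'I_k} :=
  [set i | tnth a i != `[< query s (take i a) T >]].

(* The adversary can give the answers a when the interruption time is T. *)
Definition admissible (R : realType) (k : nat) (s : scheme R k) (H : nat)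
    (T : R) (a : k.-tuple bool) : Prop :=
  (#|wrong_answers s T a| <= H)%N.

Definition selectable (R : realType) (k : nat) (s : scheme R k) (H : nat)
    (a : k.-tuple bool) : Prop :=
  exists2 T : R, 0 < T & admissible s H T a.

(* The truthful answers to any T > 0 are admissible and lengths are positive,
   so the default value 0 does not contribute to the maximum. *)
Definition max_first_length (R : realType) (k : nat) (s : scheme R k)
    (H : nat) : R :=
  \big[Num.max/0]_(a : k.-tuple bool | `[< selectable s H a >]) select s a 0%N.

Definition acceleration_ratio (R : realType) (k : nat) (s : scheme R k)
    (H : nat) : \bar R :=
  ereal_sup [set r | exists T a,
    [/\ max_first_length s H <= T, admissible s H T a
      & r = performance_ratio (select s a) T]].

(* Main.v *)
(** With p = 2^k / (1 + U) and b = 1 + p, the schedule with lengths b^(i + c)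
    has ratio at most b^(1 + 1/p) / p on every T for which the fractional part
    of log_b (p T) lies in [c, c + 1/p). So it suffices to locate this number x
    of [0, 1) in an interval of length 1/p, asking "is x < t?".

    Let I_j be the set of points consistent with all but at most j of the
    answers given so far.  As long as every threshold t is taken in I_0, the
    I_j remain nested intervals.  Berlekamp's weight sum_j |I_j| 'C(n, h - j),
    where n queries and h lies are left, can be halved by a query unless the
    median falls outside I_0 = [a_0, b_0).  In that case one asks the nearest
    endpoint of I_0: the answer that fails to halve the weight empties I_0, so
    that one lie is used up, and n is left unchanged.  This happens at most H
    times, whence k - H halving queries and a final length
    2^(H - k) * sum_(i <= H) 'C(k - H, i) = U / 2^k. *)

Require Import Defs.
From mathcomp Require Import all_boot all_order all_algebra.
From mathcomp Require Import all_classical all_reals all_analysis.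
From mathcomp Require Import zify ring lra.

Import Order.TTheory GRing.Theory Num.Theory.

Local Open Scope ring_scope.

(** * Locating a real number by threshold questions with lies *)

(** [thr] encodes an adaptive strategy: it maps the answers received so far to the next
    threshold. *)
Fixpoint lies {R : realFieldType} (thr : seq bool -> R) (ans : seq bool) (x : R) : nat :=
  if ans is c :: s then ((c != (x < thr [::])%R) + lies (fun g => thr (c :: g)) s x)%N
  else 0%N.

(* [I j x] reads: [x] may be the target, having already cost [j] of the [h]
   allowed lies. *)
Definition locatable {R : realFieldType} (L : R) (q h : nat) (I : nat -> R -> Prop) :=
  exists thr leaf : seq bool -> R, forall ans x j, size ans = q -> I j x ->
    (lies thr ans x + j <= h)%N -> leaf ans <= x < leaf ans + L.

(** The strategy asks [t], then follows the one of branch [c]. The last inequality says that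
    relabelling [j] as [j'] leaves no fewer lies, so a branch may lower its budget [h' c]. *)
Lemma locatable_query {R : realFieldType} (t L : R) (q h : nat) (I : nat -> R -> Prop)
    (h' : bool -> nat) (I' : bool -> nat -> R -> Prop) :
  (forall c, locatable L q (h' c) (I' c)) ->
  (forall c x j, I j x -> ((c != (x < t)%R) + j <= h)%N ->
     exists2 j', I' c j' x & (j' + h <= (c != (x < t)%R) + j + h' c)%N) ->
  locatable L q.+1 h I.
Proof.
move=> loc trans.
have [thr1 [leaf1 ok1]] := loc true; have [thr0 [leaf0 ok0]] := loc false.
exists (fun g => if g is c :: g' then (if c then thr1 g' else thr0 g') else t).
exists (fun g => if g is c :: g' then (if c then leaf1 g' else leaf0 g') else 0).
move=> [//|c ans] x j [sz] Ix /= le_h.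
have [|j' Ix' lej'] := trans c x j Ix; first lia.
have le_h' : (lies (if c then thr1 else thr0) ans x + j' <= h' c)%N.
  suff : ((c != (x < t)%R) + lies (if c then thr1 else thr0) ans x + j <= h)%N by lia.
  by case: c le_h {lej' Ix'}.
by case: c {le_h lej'} Ix' le_h'; [exact: ok1 | exact: ok0].
Qed.

(* By Abel summation, the measure of [I_j] minus [I_(j-1)] is weighted by the
   number of placements of at most [h - j] lies among [n] answers. *)
Definition weight {R : realFieldType} (n h : nat) (a b : nat -> R) : R :=
  \sum_(j < h.+1) (b j - a j) * 'C(n, h - j)%:R.

(* The answer "x < t" turns I_j into [a_j, push t b j), the answer "x >= t"
   into [push t a j, b_j). *)
Definition push {R : realFieldType} (t : R) (b : nat -> R) (j : nat) : R :=
  if j is j'.+1 then b j' else t.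

(** Pascal's rule splits each binomial into a part that stays at [j] and a part that shifts to
    [j + 1]; [t] cancels. Thus the two answers share the weight. *)
Lemma weight_push {R : realFieldType} (n h : nat) (t : R) (a b : nat -> R) :
  weight n h a (push t b) + weight n h (push t a) b = weight n.+1 h a b.
Proof.
rewrite /weight [in RHS]big_ord_recr /= subnn bin0.
under [in RHS]eq_bigr => j _ do rewrite -(subnSK (ltn_ord j)) binS natrD mulrDr.
rewrite big_split /=.
rewrite addrAC.
have -> : \sum_(i < h) (b i - a i) * 'C(n, (h - i.+1).+1)%:R + (b h - a h) * 1 =
          \sum_(i < h.+1) (b i - a i) * 'C(n, h - i)%:R.
  rewrite big_ord_recr /= subnn bin0; congr (_ + _).
  by apply: eq_bigr => i _; rewrite subnSK.
rewrite !big_ord_recl /= subn0.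
have -> : \sum_(i < h) (b i - a i) * 'C(n, h - i.+1)%:R =
  \sum_(i < h) (b i - a (bump 0 i)) * 'C(n, h - bump 0 i)%:R +
  \sum_(i < h) (b (bump 0 i) - a i) * 'C(n, h - bump 0 i)%:R -
  \sum_(i < h) (b (bump 0 i) - a (bump 0 i)) * 'C(n, h - bump 0 i)%:R.
  by rewrite -big_split -sumrB /=; apply: eq_bigr => i _; rewrite /bump /= add1n; ring.
by ring.
Qed.

Lemma weight_push_affine {R : realFieldType} (n h : nat) (t : R) (a b : nat -> R) :
  weight n h a (push t b) = t * 'C(n, h)%:R + weight n h a (push 0 b).
Proof. by rewrite /weight !big_ord_recl /= subn0; ring. Qed.

(** For the answer [x >= b_0]: [[a_j, b_(j+1))] lies inside the old [I_(j+1)] and inherits its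
    binomial, while the discarded term [j = 0] is nonnegative. *)
Lemma weight_dropr {R : realFieldType} (n h : nat) (a b : nat -> R) :
  {homo a : i j / (i <= j)%N >-> j <= i} -> a 0%N <= b 0%N ->
  weight n h a (fun j => b j.+1) <= weight n h.+1 a b.
Proof.
move=> am ab; rewrite /weight [leRHS]big_ord_recl /= -[leLHS]add0r lerD //.
  by rewrite mulr_ge0 ?ler0n // subr_ge0.
apply: ler_sum => i _; rewrite /bump /= add1n subSS ler_wpM2r ?ler0n //.
by rewrite lerB // am.
Qed.

Lemma weight_dropl {R : realFieldType} (n h : nat) (a b : nat -> R) :
  {homo b : i j / (i <= j)%N >-> i <= j} -> a 0%N <= b 0%N ->
  weight n h (fun j => a j.+1) b <= weight n h.+1 a b.
Proof.
move=> bm ab; rewrite /weight [leRHS]big_ord_recl /= -[leLHS]add0r lerD //.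
  by rewrite mulr_ge0 ?ler0n // subr_ge0.
apply: ler_sum => i _; rewrite /bump /= add1n subSS ler_wpM2r ?ler0n //.
by rewrite lerB // bm.
Qed.

(** The slope [c] may vanish, as ['C(n, h)] does for [n < h]; then an endpoint serves. *)
Lemma affine_clamp {R : realFieldType} (a b m c u : R) : a <= b -> 0 <= c ->
  exists2 t, a <= t <= b &
    [\/ t * c + u = m, t = b /\ t * c + u <= m | t = a /\ m <= t * c + u].
Proof.
move=> ab c0; have [le_bm|lt_mb] := leP (b * c + u) m.
  by exists b; [rewrite ab lexx | constructor 2].
have [le_ma|lt_am] := leP m (a * c + u).
  by exists a; [rewrite ab lexx | constructor 3].
have cp : 0 < c.
  rewrite lt_neqAle c0 andbT; apply/eqP => c00.
  by rewrite -c00 !mulr0 in lt_am lt_mb; lra.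
exists ((m - u) / c); last by constructor 1; field; rewrite gt_eqF.
by rewrite ler_pdivlMr // ler_pdivrMr //; lra.
Qed.

(* The hypothesis on [q] only concerns [0 < n]: once [n = 0], the remaining
   queries are wasted. *)
Lemma locate {R : realFieldType} (q n h : nat) (a b : nat -> R) (L : R) :
  {homo a : i j / (i <= j)%N >-> j <= i} ->
  {homo b : i j / (i <= j)%N >-> i <= j} -> a 0%N <= b 0%N ->
  ((0 < n)%N -> (n + h <= q)%N) -> weight n h a b <= L * 2 ^+ n ->
  locatable L q h (fun j x => a j <= x < b j).
Proof.
elim: q n h a b => [|q IHq] [|n] h a b am bm ab nh wL; last first.
- have pushb t : t <= b 0%N -> {homo push t b : i j / (i <= j)%N >-> i <= j}.
    move=> tb [|i] [|j] //= ij; last exact: bm.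
    by apply: le_trans tb _; exact: bm.
  have pusha t : a 0%N <= t -> {homo push t a : i j / (i <= j)%N >-> j <= i}.
    move=> ta [|i] [|j] //= ij; last exact: am.
    by apply: le_trans ta; exact: am.
  pose w := weight n.+1 h a b.
  (* The threshold should equalise the weights of the two answers; clamping it to [[a_0, b_0]] keeps
     the intervals nested. *)
  have := affine_clamp _ _ (w / 2) _ (weight n h a (push 0 b)) ab (ler0n R 'C(n, h)).
  move=> [t /andP[ta tb]]; rewrite -weight_push_affine => tcase.
  have wE := weight_push n h t a b; rewrite -/w in wE.
  rewrite -/w exprS in wL.
  have locl : weight n h a (push t b) <= w / 2 ->
      locatable L q h (fun j x => a j <= x < push t b j).
    by move=> lew; apply: (IHq n) => //; [exact: pushb | lia | lra].
  have locr : weight n h (push t a) b <= w / 2 ->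
      locatable L q h (fun j x => push t a j <= x < b j).
    by move=> lew; apply: (IHq n) => //; [exact: pusha | lia | lra].
  have transl x j : a j <= x < b j -> ((true != (x < t)%R) + j <= h)%N ->
      exists2 j', a j' <= x < push t b j' & (j' + h <= (true != (x < t)%R) + j + h)%N.
    move=> /andP[ax xb]; case: (ltP x t) => [xt|tx] _.
      exists j => //; rewrite ax; case: j {ax xb} => //= j.
      by apply: lt_le_trans xt (le_trans tb _); exact: bm.
    by exists j.+1 => //=; rewrite xb andbT (le_trans _ ax) // am.
  have transr x j : a j <= x < b j -> ((false != (x < t)%R) + j <= h)%N ->
      exists2 j', push t a j' <= x < b j' & (j' + h <= (false != (x < t)%R) + j + h)%N.
    move=> /andP[ax xb]; case: (ltP x t) => [xt|tx] _.
      by exists j.+1 => //=; rewrite ax (lt_le_trans xb) // bm.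
    exists j => //; rewrite xb andbT; case: j {ax xb} => //= j.
    by apply: le_trans tx; apply: le_trans ta; exact: am.
  have both : weight n h a (push t b) <= w / 2 ->
      weight n h (push t a) b <= w / 2 ->
      locatable L q.+1 h (fun j x => a j <= x < b j).
    move=> lel ler; apply: (locatable_query t _ _ _ _ (fun=> h)
      (fun c j x => if c then a j <= x < push t b j else push t a j <= x < b j)).
      by case; [exact: locl | exact: locr].
    by case=> x j /=; [exact: transl | exact: transr].
  case: tcase => [eqw|[tb0 lew]|[ta0 lew]].
  + by apply: both; lra.
  (* The answer "x >= b_0" empties I_0 and I_j+1 takes the role of I_j. *)
  + have [ler|gtr] := leP (weight n h (push t a) b) (w / 2); first exact: both.
    (* For [h = 0] the answer [x >= b_0] leaves an empty interval, against [gtr]. *)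
    case: h => [|h] in nh w wL wE lew gtr locl transl {both locr transr pusha pushb} *.
      by rewrite /w /weight !big_ord1 /= !bin0 tb0 in lew gtr; lra.
    apply: (locatable_query t _ _ _ _ (fun c : bool => if c then h.+1 else h)
      (fun c j x => if c then a j <= x < push t b j else a j <= x < b j.+1)).
      case; first exact: locl.
      apply: (IHq n.+1) => //; [|exact: le_trans ab (bm _ _ _)|lia|].
        by move=> i j ij; exact: bm.
      by rewrite exprS; apply: le_trans wL; exact: weight_dropr.
    case=> x j /=; first exact: transl.
    (* A lie is paid for by the smaller budget, so [j] stays. A true answer puts [x] outside [I_0],
       so [j] is positive and drops by one. *)
    move=> /andP[ax xb]; case: (ltP x t) => [xt|tx] _ /=.
      by exists j; [rewrite ax (lt_le_trans xb) // bm | lia].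
    case: j ax xb => [|j] ax xb; first by rewrite tb0 in tx; lra.
    exists j; last lia.
    by rewrite xb andbT (le_trans _ tx) // (le_trans _ ta) // am.
  (* Mirror image: here the answer [x < a_0] empties [I_0]. *)
  + have [lel|gtl] := leP (weight n h a (push t b)) (w / 2).
      by apply: both => //; lra.
    case: h => [|h] in nh w wL wE lew gtl locr transr {both locl transl pusha pushb} *.
      by rewrite /w /weight !big_ord1 /= !bin0 ta0 in gtl; lra.
    apply: (locatable_query t _ _ _ _ (fun c : bool => if c then h else h.+1)
      (fun c j x => if c then a j.+1 <= x < b j else push t a j <= x < b j)).
      case; last by apply: locr; lra.
      apply: (IHq n.+1) => //; [|exact: le_trans (am _ _ _) ab|lia|].
        by move=> i j ij; exact: am.
      by rewrite exprS; apply: le_trans wL; exact: weight_dropl.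
    case=> x j /=; last exact: transr.
    move=> /andP[ax xb]; case: (ltP x t) => [xt|tx] _ /=; last first.
      by exists j; [rewrite xb andbT (le_trans _ ax) // am | lia].
    case: j ax xb => [|j] ax xb; first by rewrite ta0 in xt; lra.
    exists j; last lia.
    by rewrite ax (lt_le_trans xt) // (le_trans tb) // bm.
- apply: (locatable_query 0 _ _ _ _ (fun=> h) (fun _ j x => a j <= x < b j)).
    by move=> _; exact: (IHq 0%N).
  by move=> c x j Ix _; exists j => //; lia.
- by exfalso; have := nh isT; lia.
(* Only the term [j = h] survives in the weight for [n = 0], so [I_h], which contains the other
   intervals, has length at most [L]. *)
- exists (fun=> 0), (fun=> a h) => -[|//] x j _ /andP[ax xb] /= jh.
  have : b h - a h <= L.
    move: wL; rewrite /weight big_ord_recr /= subnn bin0 expr0 big1 ?add0r; first lra.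
    by move=> i _; rewrite bin_small ?mulr0 // subn_gt0.
  rewrite add0n in jh.
  have := am _ _ jh; have := bm _ _ jh; lra.
Qed.

Lemma card_lies {R : realFieldType} (thr : seq bool -> R) (x : R) (s : seq bool) :
  (\sum_(i < size s) (nth false s i != (x < thr (take i s))%R))%N = lies thr s x.
Proof.
elim: s thr => [|c s IHs] thr /=; first by rewrite big_ord0.
by rewrite big_ord_recl /= -IHs.
Qed.

(** * Geometric schedules and their ratio *)

Definition geometric_length {R : realType} (b c : R) (i : nat) : R := b `^ (i%:R + c).

Lemma geometric_length_gt0 {R : realType} (b c : R) :
  1 < b -> forall i, 0 < geometric_length b c i.
Proof. by move=> b1 i; apply: powR_gt0; apply: lt_trans b1. Qed.

Lemma geometric_length_incr {R : realType} (b c : R) :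
  1 < b -> {homo geometric_length b c : i j / (i < j)%N >-> i < j}.
Proof.
move=> b1 i j ij; rewrite /geometric_length /powR gt_eqF ?(lt_trans _ b1) //.
by rewrite ltr_expR ltr_pM2r ?ln_gt0 // ltrD2r ltr_nat.
Qed.

Definition geometric_schedule {R : realType} (b c : R) (b1 : 1 < b) : schedule R :=
  Schedule (geometric_length_gt0 b c b1) (geometric_length_incr b c b1).

Lemma geometric_finish_time {R : realType} (b c : R) (b1 : 1 < b) (i : nat) :
  (b - 1) * finish_time (geometric_schedule b c b1) i = b `^ (i.+1%:R + c) - b `^ c.
Proof.
have b0 : 0 < b by exact: (lt_trans ltr01 b1).
have powS j : b `^ (j.+1%:R + c) = b * b `^ (j%:R + c).
  by rewrite -natr1 addrAC addrC powRD ?powRr1 1?ltW // (gt_eqF b0) implybT.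
elim: i => [|i IHi]; rewrite /finish_time.
  by rewrite big_ord1 powS /= /geometric_length add0r; ring.
rewrite big_ord_recr /= mulrDr -[\sum_(_ < _) _]/(finish_time (geometric_schedule b c b1) i).
by rewrite IHi [in RHS]powS /geometric_length; ring.
Qed.

Lemma geometric_completed {R : realType} (b c L : R) (b1 : 1 < b) (T f : R) (N : int) :
  let X := geometric_schedule b c b1 in
  X 0%N <= T -> (b - 1) * T = b `^ (N%:~R + f) -> c <= f < c + L ->
  exists2 i, finish_time X i <= T & (b - 1) * T <= b `^ (1 + L) * X i.
Proof.
move=> X X0T TE /andP[cf fL].
have b0 : 0 < b by exact: (lt_trans ltr01 b1).
have bn0 r s : (r + s == 0) ==> (b != 0) by rewrite (gt_eqF b0) implybT.
have bmono r1 r2 : r1 <= r2 -> b `^ r1 <= b `^ r2 by exact: ler_powR (ltW b1) _ _.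
case: N TE => [[|n]|n] TE.
- exists 0%N; first by rewrite /finish_time big_ord1.
  by rewrite TE /X /= /geometric_length -powRD ?bn0 //; apply: bmono; lra.
- exists n.
    rewrite -(ler_pM2l (_ : 0 < b - 1)) ?subr_gt0 // geometric_finish_time TE.
    apply: (@le_trans _ _ (b `^ (n.+1%:R + c))).
      by rewrite gerBl powR_ge0.
    by apply: bmono; rewrite lerD2l.
  rewrite TE /X /= /geometric_length -powRD ?bn0 //; apply: bmono.
  by rewrite -pmulrn -natr1; lra.
- exists 0%N; first by rewrite /finish_time big_ord1.
  rewrite TE /X /= /geometric_length -powRD ?bn0 //; apply: bmono.
  by rewrite NegzE mulrNz -pmulrn; have := ler0n R n.+1; lra.
Qed.

Lemma performance_ratio_le {R : realType} (X : schedule R) (T r : R) (i : nat) :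
  0 <= T -> finish_time X i <= T -> T <= r * X i -> (performance_ratio X T <= r%:E)%E.
Proof.
move=> T0 Ti Tr; have cT : (completed X T !=set0)%classic by exists i.
rewrite /performance_ratio (asboolT cT) lee_fin.
have [j _ [-> /(_ i Ti) Xij]] := longest_completed_max cT.
have Xi := contract_length_gt0 X i.
rewrite ler_pdivrMr ?(lt_le_trans Xi) //; apply: (le_trans Tr).
by rewrite ler_wpM2l //; have := le_trans T0 Tr; rewrite pmulr_lge0.
Qed.

(** * Admissible answers and first contract lengths *)

Lemma truthful_answers {R : realType} {k : nat} (s : scheme R k) (T : R) :
  exists a : k.-tuple bool, #|wrong_answers s T a| = 0%N.
Proof.
have [a sza tr] : exists2 a : seq bool, size a = k &
    forall i, (i < k)%N -> nth false a i = `[< query s (take i a) T >].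
  have tr n : exists2 a : seq bool, size a = n &
      forall i, (i < n)%N -> nth false a i = `[< query s (take i a) T >].
    elim: n => [|n [a sza tr]]; first by exists [::].
    exists (rcons a `[< query s a T >]); first by rewrite size_rcons sza.
    move=> i; rewrite ltnS leq_eqVlt => /predU1P[->|lt_in].
      by rewrite nth_rcons sza ltnn eqxx -cats1 take_cat sza ltnn subnn take0 cats0.
    by rewrite nth_rcons -cats1 take_cat sza lt_in tr.
  exact: tr.
have sza' : size a == k by apply/eqP.
exists (Tuple sza'); apply: eq_card0 => i.
by rewrite !inE (tnth_nth false) /= tr // eqxx.
Qed.

Lemma select_le_max_first_length {R : realType} {k H : nat} (s : scheme R k)
    (a : k.-tuple bool) :
  selectable s H a -> select s a 0%N <= max_first_length s H.
Proof. by move=> /asboolP sa; apply: le_bigmax_cond. Qed.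

Lemma max_first_length_gt0 {R : realType} {k H : nat} (s : scheme R k) :
  0 < max_first_length s H.
Proof.
have [a wa] := truthful_answers s 1.
apply: lt_le_trans (contract_length_gt0 (select s a) 0%N) _.
by apply: select_le_max_first_length; exists 1; rewrite // /admissible wa.
Qed.

Theorem theorem5 (R : realType) (k H : nat)
    (k_ge1 : (1 <= k)%N) (H_le : (2 * H <= k)%N) :
  let U : R := 2 ^+ H * \sum_(0 <= i < H.+1) 'C(k - H, i)%:R in
  exists s : scheme R k,
    (acceleration_ratio s H <=
      ((1 + U) / 2 ^+ k *
        (1 + 2 ^+ k / (1 + U)) `^ (1 + (1 + U) / 2 ^+ k))%:E)%E.
Proof.
move=> U; pose L : R := (1 + U) / 2 ^+ k.
have U0 : 0 <= U by rewrite mulr_ge0 ?exprn_ge0 // sumr_ge0.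
have L0 : 0 < L by rewrite divr_gt0 ?exprn_gt0 //; lra.
have LE : 2 ^+ k / (1 + U) = L^-1 by rewrite /L invf_div.
rewrite LE -/L; pose b : R := 1 + L^-1.
have b1 : 1 < b by rewrite ltrDl invr_gt0.
have b0 : 0 < b by exact: (lt_trans ltr01 b1).
have bE : b - 1 = L^-1 by rewrite /b addrAC subrr add0r.
have [thr [leaf loc]] : locatable L k H (fun _ x => 0 <= x < 1).
  (* Initially every [I_j] is [[0, 1)], so the weight is [U / 2 ^+ H] and the required bound reduces
     to [U <= 1 + U]. *)
  apply: (locate k (k - H) H (fun=> 0) (fun=> 1)) => //; first lia.
  rewrite /weight (reindex_inj rev_ord_inj) /= /L mulrC mulrA.
  rewrite ler_pdivlMr ?exprn_gt0 //.
  have -> : \sum_(j < H.+1) (1 - 0) * 'C(k - H, H - (H.+1 - j.+1))%:R =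
            \sum_(0 <= i < H.+1) 'C(k - H, i)%:R :> R.
    rewrite big_mkord; apply: eq_bigr => i _.
    by rewrite subr0 mul1r subSS subKn // -ltnS.
  have -> : (2 : R) ^+ k = 2 ^+ (k - H) * 2 ^+ H by rewrite -exprD; congr (_ ^+ _); lia.
  by rewrite mulrCA [_ * 2 ^+ H]mulrC -/U ler_pM2l ?exprn_gt0 // lerDr.
(* The factor [b - 1] clears the denominator of the geometric finish times. *)
pose lg (T : R) := ln ((b - 1) * T) / ln b.
pose phi T := lg T - (Num.floor (lg T))%:~R.
have qgt0 (h : seq bool) t : [set T : R | 0 < T /\ phi T < thr h]%classic t -> 0 < t.
  by case.
pose s : scheme R k :=
  Scheme qgt0 (fun a : k.-tuple bool => geometric_schedule b (leaf a) b1).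
exists s; apply: ge_ereal_sup => _ [T [a [leT adm ->]]].
have T0 : 0 < T by apply: lt_le_trans leT; exact: max_first_length_gt0.
have X0T : select s a 0%N <= T.
  by apply: le_trans leT; apply: select_le_max_first_length; exists T.
have lief : (lies thr a (phi T) <= H)%N.
  apply: leq_trans adm; rewrite -card_lies size_tuple -sum1dep_card [leqRHS]big_mkcond /=.
  apply: leq_sum => i _; rewrite (tnth_nth false).
  have -> : `[< 0 < T /\ phi T < thr (take i a) >] =
      (phi T < thr (take i a)) by apply/asboolP/idP => [[]|].
  by case: (_ != _).
have phi01 : 0 <= phi T < 1.
  by rewrite /phi subr_ge0 floor_le ltrBlDl; have := floorD1_gt (lg T); rewrite intrD1.
have leafphi : leaf a <= phi T < leaf a + L.
  by apply: (loc a (phi T) 0%N); rewrite ?size_tuple // addn0.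
have TE : (b - 1) * T = b `^ ((Num.floor (lg T))%:~R + phi T).
  rewrite /phi [in RHS]addrC subrK /powR gt_eqF // /lg divfK ?lnK ?gt_eqF ?ln_gt0 //.
  by rewrite posrE mulr_gt0 // subr_gt0.
have [i iT Xi] := geometric_completed _ _ _ b1 _ _ _ X0T TE leafphi.
apply: (performance_ratio_le _ _ _ i) => //; first exact: ltW.
(* Dividing by [b - 1 = L^-1] produces the leading factor [L]. *)
by rewrite -mulrA -ler_pdivrMl //; move: Xi; rewrite bE.
Qed.
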